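(* Let $\mathcal{Z}$ be a reflexive Banach space, $N\ge 0$ an integer, $\mathcal{D}_0,\dots,\mathcal{D}_N$ Hilbert spaces, $\mathbf{z}_0^b\in\mathcal{Z}$, and $\mathbf{y}_k\in\mathcal{D}_k$ for $0\le k\le N$. Let $\mathbf{B}$, $\mathbf{R}_k$, $\mathbf{L}_k$ ($0\le k\le N$) be symmetric positive-definite covariance operators as described in the context, satisfying the predictability assumption that $\mathbf{R}_k^{-1}-\mathbf{L}_k^{-1}$ is positive definite for every $k$. Let $Q_k:\mathcal{Z}\to\mathcal{D}_k$ ($0\le k\le N$) be Fréchet differentiable bounded linear operators, each of full rank. Define $\mathcal{J}_{\mathrm{DC}}:\mathcal{Z}\to\mathbb{R}$ by $$\mathcal{J}_{\mathrm{DC}}(\mathbf{z}_0)=\tfrac12\|\mathbf{z}_0-\mathbf{z}_0^b\|_{\mathbf{B}^{-1}}^2+\tfrac12\sum_{k=0}^N\|\mathbf{y}_k-Q_k\mathbf{z}_0\|_{\mathbf{R}_k^{-1}}^2-\tfrac12\sum_{k=0}^N\|Q_k\mathbf{z}_0-Q_k\mathbf{z}_0^b\|_{\mathbf{L}_k^{-1}}^2 .$$ Then $\mathcal{J}_{\mathrm{DC}}$ admits a unique minimizer $\mathbf{z}^{\mathrm{MUD}}\in\mathcal{Z}$.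
   Context: All spaces are real. The precision operator $\mathbf{B}^{-1}:\mathcal{Z}\to\mathcal{Z}^*$ is bounded, symmetric and positive definite in the sense that there is a constant $\lambda_{\min}(\mathbf{B}^{-1})>0$ with $\langle\mathbf{B}^{-1}\mathbf{v},\mathbf{v}\rangle\ge\lambda_{\min}(\mathbf{B}^{-1})\|\mathbf{v}\|_{\mathcal{Z}}^2$ for all $\mathbf{v}\in\mathcal{Z}$; $\|\mathbf{v}\|_{\mathbf{B}^{-1}}^2:=\langle\mathbf{B}^{-1}\mathbf{v},\mathbf{v}\rangle$. For each $k$, $\mathbf{R}_k$ and $\mathbf{L}_k$ are bounded, symmetric (self-adjoint) positive-definite operators on $\mathcal{D}_k$ with bounded inverses; $\|\mathbf{d}\|_{\mathbf{R}_k^{-1}}^2:=\langle\mathbf{R}_k^{-1}\mathbf{d},\mathbf{d}\rangle$ and $\|\mathbf{d}\|_{\mathbf{L}_k^{-1}}^2:=\langle\mathbf{L}_k^{-1}\mathbf{d},\mathbf{d}\rangle$ for $\mathbf{d}\in\mathcal{D}_k$. The predictability assumption: the operator $\mathbf{W}_k^{-1}:=\mathbf{R}_k^{-1}-\mathbf{L}_k^{-1}$ satisfies $\langle\mathbf{W}_k^{-1}\mathbf{d},\mathbf{d}\rangle>0$ for all $\mathbf{d}\in\mathcal{D}_k\setminus\{0\}$ and all $k$. ''Full rank'' means of maximal rank, i.e. $Q_k$ is injective or surjective. The minimizer is called the maximal updated density (MUD) point. *)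

(* Defs.v *)
From HB Require Import structures.
From mathcomp Require Import all_boot all_order all_algebra.
From mathcomp Require Import all_classical all_reals all_analysis.

Set Implicit Arguments.
Unset Strict Implicit.
Unset Printing Implicit Defensive.

Import Order.TTheory GRing.Theory Num.Theory.
Import numFieldNormedType.Exports.

Local Open Scope classical_set_scope.
Local Open Scope ring_scope.

HB.mixin Record NormedModule_hasInner (R : realType) V
    & NormedModule R V := {
  inner : {dot V for @idfun R} ;
  inner_norm : forall x : V, inner x x = `|x| ^+ 2
}.

#[short(type="hilbertType")]
HB.structure Definition Hilbert (R : realType) :=
  {V of CompleteNormedModule R V & NormedModule_hasInner R V}.

Section Dual.
Context {R : realType} (V : normedModType R).

Definition dual_pred : {pred V -> R} :=
  [pred f : V -> R | `[< linear (f : V -> R^o) /\ bounded_fun_norm f >]].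

Record dual := Dual { dual_val :> V -> R ; dualP : dual_val \in dual_pred }.

HB.instance Definition _ := [isSub for dual_val].
HB.instance Definition _ := [Choice of dual by <:].

Lemma dual_linear (f : dual) : linear (f : V -> R^o).
Proof. by have /asboolP[] := dualP f. Qed.

Lemma dual_bounded (f : dual) : bounded_fun_norm f.
Proof. by have /asboolP[] := dualP f. Qed.

HB.instance Definition _ (f : dual) :=
  GRing.isLinear.Build R V R^o _ (dual_val f) (dual_linear f).

Lemma dual_submod_closed : @submod_closed R (V -> R^o) dual_pred.
Proof.
split=> [|a f g /asboolP[fl fb] /asboolP[gl gb]]; apply/asboolP; split.
- by move=> a x y; rewrite /= scaler0 addr0.
- by move=> r; exists 0 => x _; rewrite /= normr0.
- move=> b x y; have := fl b x y; have := gl b x y.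
  rewrite /= !fctE => -> ->.
  by rewrite !scalerDr !scalerA mulrC addrACA.
- move=> r; have [M fM] := fb r; have [M' gM'] := gb r.
  exists (`|a| * M + M') => x xr; rewrite fctE.
  rewrite (le_trans (ler_normD _ _))// lerD ?gM'// normrM.
  by rewrite ler_wpM2l ?fM.
Qed.

HB.instance Definition _ :=
  GRing.isSubmodClosed.Build R (V -> R^o) dual_pred dual_submod_closed.
HB.instance Definition _ := [SubChoice_isSubLmodule of dual by <:].

Lemma dualDE (f g : dual) x : (f + g) x = f x + g x. Proof. by []. Qed.

Lemma dualZE a (f : dual) x : (a *: f) x = a * f x. Proof. by []. Qed.

Definition dual_norm (f : dual) : R :=
  sup [set `|f x| | x in [set x : V | `|x| <= 1]].

Lemma dual_norm_has_sup (f : dual) :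
  has_sup [set `|f x| | x in [set x : V | `|x| <= 1]].
Proof.
split; first by exists `|f 0|, 0 => //=; rewrite normr0.
by have [M fM] := dual_bounded f 1; exists M => _ [x /= x1 <-]; exact: fM.
Qed.

Lemma dual_norm_ub (f : dual) x : `|f x| <= dual_norm f * `|x|.
Proof.
have [->|x0] := eqVneq x 0; first by rewrite linear0 !normr0 mulr0.
have nx : 0 < `|x| by rewrite normr_gt0.
rewrite -ler_pdivrMr//; apply: sup_ubound.
  by have [] := dual_norm_has_sup f.
exists (`|x|^-1 *: x) => /=.
  by rewrite normrZ normfV normr_id mulVf ?gt_eqF.
by rewrite linearZ /= normrM normfV normr_id mulrC.
Qed.

Lemma dual_norm_le (f : dual) M :
  (forall x, `|x| <= 1 -> `|f x| <= M) -> dual_norm f <= M.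
Proof.
move=> fM; apply: ge_sup; first by have [] := dual_norm_has_sup f.
by move=> _ [x /= x1 <-]; exact: fM.
Qed.

Lemma dual_norm_ge0 (f : dual) : 0 <= dual_norm f.
Proof.
apply: (@le_trans _ _ `|f 0|) => //; apply: sup_ubound.
  by have [] := dual_norm_has_sup f.
by exists 0 => //=; rewrite normr0.
Qed.

Lemma dual_norm_ub1 (f : dual) x : `|x| <= 1 -> `|f x| <= dual_norm f.
Proof.
by move=> x1; rewrite (le_trans (dual_norm_ub f x))// ler_piMr ?dual_norm_ge0.
Qed.

Lemma dual_normD (f g : dual) : dual_norm (f + g) <= dual_norm f + dual_norm g.
Proof.
apply: dual_norm_le => x x1; rewrite dualDE (le_trans (ler_normD _ _))//.
by rewrite lerD// dual_norm_ub1.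
Qed.

Lemma dual_normZ_le a (f : dual) : dual_norm (a *: f) <= `|a| * dual_norm f.
Proof.
apply: dual_norm_le => x x1; rewrite dualZE normrM.
by rewrite ler_wpM2l ?dual_norm_ub1.
Qed.

Lemma dual_norm0_eq0 (f : dual) : dual_norm f = 0 -> f = 0.
Proof.
move=> f0; apply/val_inj/funext => x /=; apply/eqP.
by rewrite -normr_le0 (le_trans (dual_norm_ub f x))// f0 mul0r.
Qed.

Lemma dual_normZ a (f : dual) : dual_norm (a *: f) = `|a| * dual_norm f.
Proof.
apply/eqP; rewrite eq_le dual_normZ_le /=.
have [->|a0] := eqVneq a 0; first by rewrite normr0 mul0r dual_norm_ge0.
rewrite -ler_pdivlMl ?normr_gt0// -normfV.
by rewrite -{1}[f](scalerK a0) dual_normZ_le.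
Qed.

HB.instance Definition _ :=
  Lmodule_isNormed.Build R dual dual_normD dual_normZ dual_norm0_eq0.

Lemma dual_normE (f : dual) :
  `|f| = sup [set `|f x| | x in [set x : V | `|x| <= 1]].
Proof. by []. Qed.

End Dual.

Arguments dual_pred {R} V.

Section Reflexive.
Context {R : realType} (V : normedModType R).

Lemma bidual_eval_subproof (v : V) :
  (fun f : dual V => f v) \in dual_pred (dual V).
Proof.
apply/asboolP; split=> [//|r]; exists (r * `|v|) => f fr.
by rewrite (le_trans (dual_norm_ub f v))// ler_wpM2r.
Qed.

Definition bidual_eval (v : V) : dual (dual V) := Dual (bidual_eval_subproof v).

Definition reflexive_space := forall phi : dual (dual V),
  exists v : V, bidual_eval v = phi.

End Reflexive.

Section Operators.
Context {R : realType}.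

(* [bounded_fun_norm A] says that A maps bounded sets to bounded sets, which for
   linear A is boundedness in the operator norm. An inverse operator A^-1 is a
   separate argument Ainv, tied to A by [inverse_operators]. The duality pairing
   <f, v> of f : dual Z with v : Z is f v. *)

Definition precision_operator (Z : normedModType R)
    (Binv : {linear Z -> dual Z}) :=
  [/\ bounded_fun_norm Binv,
      forall u v : Z, Binv u v = Binv v u &
      exists2 lmin : R, 0 < lmin & forall v : Z, lmin * `|v| ^+ 2 <= Binv v v].

Definition self_adjoint (H : hilbertType R) (A : H -> H) :=
  forall u v : H, inner (A u) v = inner u (A v).

Definition positive_definite (H : hilbertType R) (A : H -> H) :=
  forall d : H, d != 0 -> 0 < inner (A d) d.

Definition inverse_operators (U V : Type) (A : U -> V) (Ainv : V -> U) :=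
  cancel A Ainv /\ cancel Ainv A.

Definition covariance_operator (H : hilbertType R) (A Ainv : {linear H -> H}) :=
  [/\ bounded_fun_norm A, self_adjoint A, positive_definite A,
      inverse_operators A Ainv & bounded_fun_norm Ainv].

Definition full_rank (U V : Type) (Q : U -> V) :=
  injective Q \/ range Q = setT.

Definition sqnorm_dual (Z : normedModType R) (Binv : Z -> dual Z) (v : Z) : R :=
  Binv v v.

Definition sqnorm_op (H : hilbertType R) (A : H -> H) (d : H) : R :=
  inner (A d) d.

Definition J_DC (Z : normedModType R) (N : nat) (D : 'I_N.+1 -> hilbertType R)
    (Binv : Z -> dual Z) (Rinv Linv : forall k, D k -> D k)
    (Q : forall k, Z -> D k) (zb : Z) (y : forall k, D k) (z : Z) : R :=
  2^-1 * sqnorm_dual Binv (z - zb)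
  + 2^-1 * \sum_(k < N.+1) sqnorm_op (Rinv k) (y k - Q k z)
  - 2^-1 * \sum_(k < N.+1) sqnorm_op (Linv k) (Q k z - Q k zb).

Definition minimizer (T : Type) (J : T -> R) (x : T) :=
  forall x' : T, J x <= J x'.

End Operators.

(* Main.v *)
(** The quadratic part of [J_DC] is
    <B^-1 w, w> + sum_k <(R_k^-1 - L_k^-1) Q_k w, Q_k w>, which by
    predictability is at least lambda_min |w|^2. The parallelogram law therefore
    makes [J_DC] strongly convex along midpoints. A continuous function with
    this property is bounded below, its minimizing sequences are Cauchy, and
    completeness of Z gives a minimizer, unique by strong convexity. *)
Require Import Defs.
From HB Require Import structures.
From mathcomp Require Import all_boot all_order all_algebra.
From mathcomp Require Import all_classical all_reals all_analysis.
From mathcomp Require Import ring lra.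

Set Implicit Arguments.
Unset Strict Implicit.
Unset Printing Implicit Defensive.

Import Order.TTheory GRing.Theory Num.Theory.
Import numFieldNormedType.Exports.

Local Open Scope ring_scope.

(** * Minimization of continuous, strongly midpoint-convex functions *)

Definition strongly_midconvex (R : realType) (Z : normedModType R) (c : R)
    (J : Z -> R) :=
  forall x y : Z, J (2^-1 *: (x + y)) + c * `|x - y| ^+ 2 <= 2^-1 * (J x + J y).

(** Continuity bounds [g] below near 0. Repeated halving brings any point into that region, and each
    step back doubles both the bound and the norm, so the bound stays linear. *)
Lemma midconvex_linear_lower_bound (R : realType) (Z : normedModType R)
    (g : Z -> R) :
  {for 0, continuous g} -> g 0 = 0 ->
  (forall z, 2 * g (2^-1 *: z) <= g z) ->
  exists K : R, forall z, - (1 + K * `|z|) <= g z.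
Proof.
move=> g_cont g0 g_half.
have [d /= d0 gd] : nbhs_ball (0 : Z) [set z | - 1 < g z]%classic.
  apply/nbhs_ballP/(cvgr_gt (g 0) g_cont); by rewrite g0 ltrN10.
have gsmall z : `|z| < d -> - 1 <= g z.
  move=> zd; apply/ltW/gd; by rewrite -ball_normE /= sub0r normrN.
(* With slope [2 / d], the term [2 / d * |z|] is at least 1 once [|z|] reaches [d / 2], so it
   absorbs the local bound [- 1]. *)
have K0 : 0 < 2 / d by rewrite divr_gt0.
(* The iteration stays outside the ball of radius [d / 2], where the bound has
   no constant term and is therefore preserved by doubling. *)
have gbig n z : d / 2 <= `|z| -> `|z| < 2 ^+ n * d -> - (2 / d * `|z|) <= g z.
  elim: n z => [|n IH] z dz zd.
    rewrite expr0 mul1r in zd; apply: le_trans (gsmall z zd); rewrite lerN2.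
    by rewrite mulrC mulrA ler_pdivlMr// mul1r -ler_pdivrMr.
  have [/gsmall|dz1] := ltP `|z| d.
    apply: le_trans; rewrite lerN2.
    by rewrite mulrC mulrA ler_pdivlMr// mul1r -ler_pdivrMr.
  have nz : `|2^-1 *: z| = `|z| / 2.
    by rewrite normrZ ger0_norm ?invr_ge0// mulrC.
  have /IH : d / 2 <= `|2^-1 *: z| by rewrite nz ler_pM2r.
  rewrite nz ltr_pdivrMr// mulrAC -exprSr => /(_ zd).
  by have := g_half z; lra.
exists (2 / d) => z; have [zd|dz] := ltP `|z| (d / 2).
  have := mulr_ge0 (ltW K0) (normr_ge0 z).
  have := @gsmall z; rewrite (lt_trans zd) ?gtr_pMr ?invf_lt1 ?ltr1n//.
  by move=> /(_ isT); lra.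
have [n zn] : exists n, `|z| < 2 ^+ n * d.
  exists (Num.truncn (`|z| / d)).+1; rewrite -ltr_pdivrMr//.
  apply: lt_trans (truncnS_gt _) _.
  by rewrite -natrX ltr_nat ltn_expl.
by have := gbig n z dz zn; lra.
Qed.

(** Midpoint convexity and continuity at 0 give a lower bound that decreases at most linearly; the
    quadratic gain with factor [c] dominates it. *)
Lemma strongly_midconvex_bounded_below (R : realType) (Z : normedModType R)
    (c : R) (J : Z -> R) :
  0 < c -> {for 0, continuous J} -> strongly_midconvex c J ->
  exists m : R, forall z, m <= J z.
Proof.
move=> c0 Jc Jmid; pose g z := J z - J 0.
have g_half z : 2 * g (2^-1 *: z) + 2 * c * `|z| ^+ 2 <= g z.
  by have := Jmid z 0; rewrite addr0 subr0 /g; lra.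
have [||z|K gK] := @midconvex_linear_lower_bound _ _ g.
- by apply: cvgB => //; exact: cvg_cst.
- by rewrite /g subrr.
- by have := g_half z; have := mulr_ge0 (ltW c0) (sqr_ge0 `|z|); lra.
(* Complete the square in [- K t + 2 c t ^ 2 - 2], the bound that one more
   halving gives at [t = `|z|]. *)
exists (J 0 - 2 - K ^+ 2 / (8 * c)) => z.
have -> : J z = g z + J 0 by rewrite subrK.
have := g_half z; have := gK (2^-1 *: z).
rewrite normrZ ger0_norm ?invr_ge0//.
have : 0 <= 2 * c * (`|z| - K / (4 * c)) ^+ 2.
  by rewrite mulr_ge0 ?sqr_ge0 ?mulr_ge0 ?ltW.
have -> : 2 * c * (`|z| - K / (4 * c)) ^+ 2 =
    2 * c * `|z| ^+ 2 - K * `|z| + K ^+ 2 / (8 * c).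
  by field; rewrite gt_eqF.
by lra.
Qed.

Lemma strongly_midconvex_unique_minimizer (R : realType)
    (Z : completeNormedModType R) (c : R) (J : Z -> R) :
  0 < c -> continuous J -> strongly_midconvex c J ->
  exists! x : Z, minimizer J x.
Proof.
move=> c0 Jc Jmid.
have [b Jb] := strongly_midconvex_bounded_below c0 (Jc 0) Jmid.
have Jinf : has_inf (range J).
  by split; [exists (J 0), 0|exists b => _ [z _ <-]; exact: Jb].
pose m := inf (range J).
have mJ z : m <= J z by apply: ge_inf => //; exact: Jinf.2.
have /choice[u Ju] : forall n : nat, exists z, J z < m + n.+1%:R^-1.
  move=> n; have n0 : 0 < n.+1%:R^-1 :> R by rewrite invr_gt0.
  by have [_ [z _ <-] ?] := inf_adherent n0 Jinf; exists z.
(* The value at the midpoint is at least [m], which leaves less than [e] for the strong convexity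
   term. *)
have dist x y e : J x < m + e -> J y < m + e -> c * `|x - y| ^+ 2 < e.
  by have := Jmid x y; have := mJ (2^-1 *: (x + y)); lra.
have near_inf e : 0 < e -> \forall n \near \oo%classic, J (u n) < m + e.
  move=> e0; near=> n; apply: lt_trans (Ju n) _; rewrite ltrD2l.
  by near: n; exact: near_infty_natSinv_lt (PosNum e0).
have /cauchy_cvg/cvg_ex[x ux] : cauchy (u @ \oo)%classic.
  apply/cauchy_ballP => e e0; near_simpl.
  (* The tolerance [c * e ^+ 2] is what [dist] turns into a distance below [e]. *)
  have Jn : \forall n \near \oo%classic, J (u n) < m + c * e ^+ 2.
    by apply: near_inf; rewrite mulr_gt0// exprn_gt0.
  near=> n; rewrite -ball_normE /=.
  rewrite -(ltr_pXn2r (_ : 0 < 2)%N) ?nnegrE ?normr_ge0 ?ltW//.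
  rewrite -(ltr_pM2l c0); apply: dist.
  - by near: n; exact: (cvg_fst Jn).
  - by near: n; exact: (cvg_snd Jn).
have Jx z : J x <= J z.
  apply/ler_addgt0Pr => e e0.
  have uJ : (J \o u @ \oo --> J x)%classic by exact: continuous_cvg (Jc x) ux.
  apply: (cvgr_to_le uJ).
  near=> n; apply: (@le_trans _ _ (m + e)); last by rewrite lerD2r.
  by apply/ltW; near: n; exact: near_inf.
exists x; split=> // y Jy.
(* The midpoint of two distinct minimizers would have a strictly smaller value. *)
apply/eqP; rewrite -subr_eq0 -normr_le0; apply/negP => /negP.
rewrite -ltNge => xy.
have := Jmid x y; have := Jx (2^-1 *: (x + y)); have := Jx y; have := Jy x.
have : 0 < c * `|x - y| ^+ 2 by rewrite mulr_gt0// exprn_gt0.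
by lra.
Unshelve. all: by end_near. Qed.

(** * Continuity of the quadratic forms *)

Lemma bounded_fun_norm_continuous (R : realType) (V W : normedModType R)
    (f : {linear V -> W}) : bounded_fun_norm f -> continuous f.
Proof. by move=> /bounded_funP/bounded_linear_continuous. Qed.

Lemma inner_polarization (R : realType) (H : hilbertType R) (u v : H) :
  inner u v = 4^-1 * (`|u + v| ^+ 2 - `|u - v| ^+ 2).
Proof.
by rewrite -!inner_norm hnormD hnormB /=; lra.
Qed.

(** Polarization reduces this to continuity of the norm. *)
Lemma continuous_inner (R : realType) (H : hilbertType R)
    (T : topologicalType) (f g : T -> H) :
  continuous f -> continuous g -> continuous (fun t => inner (f t) (g t)).
Proof.
move=> fc gc t.
have -> : (fun s => inner (f s) (g s)) =
    (fun s => 4^-1 *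
      (`|f s + g s| * `|f s + g s| - `|f s - g s| * `|f s - g s|)).
  by apply/funext => s; rewrite inner_polarization !expr2.
apply: cvgM; first exact: cvg_cst.
have ? := fc t; have ? := gc t.
have ? : (`|f s + g s| @[s --> t] --> `|f t + g t|)%classic.
  by apply: cvg_norm; apply: cvgD.
have ? : (`|f s - g s| @[s --> t] --> `|f t - g t|)%classic.
  by apply: cvg_norm; apply: cvgB.
by apply: cvgB; apply: cvgM.
Qed.

Lemma continuous_sqnorm_op (R : realType) (H : hilbertType R)
    (A : {linear H -> H}) : bounded_fun_norm A -> continuous (sqnorm_op A).
Proof.
move=> /bounded_fun_norm_continuous Ac; apply: continuous_inner => // x.
exact: cvg_id.
Qed.

(** Split [A v v] as [A x v + (A v - A x) v]: the first term converges because [A x] is continuous,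
    and the second is at most [|A v - A x| * |v|], which tends to 0. *)
Lemma continuous_sqnorm_dual (R : realType) (Z : normedModType R)
    (A : {linear Z -> dual Z}) :
  bounded_fun_norm A -> continuous (sqnorm_dual A).
Proof.
move=> /bounded_fun_norm_continuous Ac x.
rewrite /sqnorm_dual.
have Axx : (A x v @[v --> x] --> A x x)%classic.
  exact: (bounded_fun_norm_continuous (dual_bounded (A x))).
apply: cvg_sub0 Axx; apply/norm_cvg0P.
have dist0 : (`|A v - A x| * `|v| @[v --> x] --> 0)%classic.
  rewrite -[X in (_ --> X)%classic](mul0r `|x|).
  apply: cvgM; last exact: cvg_norm.
  by apply/norm_cvg0P/subr_cvg0/Ac.
apply: squeeze_cvgr dist0; last exact: cvg_cst.
apply: nearW => v; rewrite normr_ge0 /=.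
exact: (dual_norm_ub (A v - A x)).
Qed.

(** * Parallelogram laws *)

Lemma midpointB (R : realType) (V : lmodType R) (a b c d : V) :
  2^-1 *: ((a - b) + (c - d)) = 2^-1 *: (a + c) - 2^-1 *: (b + d).
Proof. by rewrite addrACA -opprD scalerBr. Qed.

Lemma midpointxx (R : realType) (V : lmodType R) (a : V) : 2^-1 *: (a + a) = a.
Proof.
by rewrite -mulr2n -[a *+ 2]scaler_nat scalerA mulVf ?scale1r ?pnatr_eq0.
Qed.

(** The cross terms cancel on expansion. An exact identity is wanted because the [Linv] forms enter
    [J_DC] with a minus sign. *)
Lemma sqnorm_op_midpoint (R : realType) (H : hilbertType R)
    (A : {linear H -> H}) (u v : H) :
  sqnorm_op A (2^-1 *: (u + v)) + 4^-1 * sqnorm_op A (u - v) =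
  2^-1 * (sqnorm_op A u + sqnorm_op A v).
Proof.
rewrite /sqnorm_op [A (_ *: _)]linearZ [A (u + v)]linearD [A (u - v)]linearB /=.
rewrite linearZl_LR linearZr_LR /=.
have -> : inner (A u - A v) (u - v) =
    inner (A u) u - inner (A u) v - (inner (A v) u - inner (A v) v).
  by rewrite linearBl /= linearBr linearBr.
have -> : inner (A u + A v) (u + v) =
    inner (A u) u + inner (A u) v + (inner (A v) u + inner (A v) v).
  by rewrite linearDl /= linearDr linearDr.
by lra.
Qed.

Lemma sqnorm_dual_midpoint (R : realType) (Z : normedModType R)
    (A : {linear Z -> dual Z}) (u v : Z) :
  sqnorm_dual A (2^-1 *: (u + v)) + 4^-1 * sqnorm_dual A (u - v) =
  2^-1 * (sqnorm_dual A u + sqnorm_dual A v).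
Proof.
have AD w : A (u + v) w = A u w + A v w by rewrite linearD.
have AB w : A (u - v) w = A u w - A v w by rewrite linearB.
have AZ a x w : A (a *: x) w = a * A x w by rewrite linearZ.
have Z2 w a x : A w (a *: x) = a * A w x by rewrite linearZ.
rewrite /sqnorm_dual AZ Z2 AD AB !linearD !linearN /=.
by lra.
Qed.

Theorem theoremB2 (R : realType) (Z : completeNormedModType R) (N : nat)
    (D : 'I_N.+1 -> hilbertType R) (zb : Z) (y : forall k, D k)
    (B : {linear dual Z -> Z}) (Binv : {linear Z -> dual Z})
    (Rk Rinv Lk Linv : forall k, {linear D k -> D k})
    (Q : forall k, {linear Z -> D k}) :
  reflexive_space Z ->
  inverse_operators B Binv -> precision_operator Binv ->
  (forall k, covariance_operator (Rk k) (Rinv k)) ->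
  (forall k, covariance_operator (Lk k) (Linv k)) ->
  (forall k, positive_definite (fun d : D k => Rinv k d - Linv k d)) ->
  (forall k, bounded_fun_norm (Q k)) ->
  (forall k (z : Z), differentiable (Q k) z) ->
  (forall k, full_rank (Q k)) ->
  exists! zMUD : Z, minimizer (J_DC Binv Rinv Linv Q zb y) zMUD.
Proof.
move=> _ _ [Bb _ [l l0 Bl]] HR HL HW Qb _ _.
have Qc k : continuous (Q k) := bounded_fun_norm_continuous (Qb k).
have RL k (d : D k) : sqnorm_op (Linv k) d <= sqnorm_op (Rinv k) d.
  have [->|/HW] := eqVneq d 0; first by rewrite /sqnorm_op !linear0.
  by rewrite linearBl subr_gt0 => /ltW.
have Qmid k u v : Q k (2^-1 *: (u + v)) = 2^-1 *: (Q k u + Q k v).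
  by rewrite linearZ linearD.
(* The [Linv] term alone is concave along midpoints, so it is paired with the [Rinv] term of the
   same index. *)
pose t k z :=
  sqnorm_op (Rinv k) (y k - Q k z) - sqnorm_op (Linv k) (Q k z - Q k zb).
have JE : J_DC Binv Rinv Linv Q zb y =
    fun z => 2^-1 * sqnorm_dual Binv (z - zb) + 2^-1 * \sum_(k < N.+1) t k z.
  by apply/funext => z; rewrite /J_DC sumrB mulrBr addrA.
have t_mid k u v : t k (2^-1 *: (u + v)) <= 2^-1 * (t k u + t k v).
  have := sqnorm_op_midpoint (Rinv k) (y k - Q k u) (y k - Q k v).
  (* [u] and [v] are swapped so that both defects are taken at [Q k v - Q k u], where [RL] compares
     them. *)
  have := sqnorm_op_midpoint (Linv k) (Q k v - Q k zb) (Q k u - Q k zb).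
  have := RL k (Q k v - Q k u).
  have -> : y k - Q k u - (y k - Q k v) = Q k v - Q k u.
    by rewrite opprB addrC addrA subrK.
  have -> : Q k v - Q k zb - (Q k u - Q k zb) = Q k v - Q k u.
    by rewrite opprB addrA subrK.
  rewrite !midpointB !midpointxx -!Qmid [v + u]addrC /t.
  by lra.
(* The constant is the coercivity bound [l] times [1 / 2] from [J_DC] and [1 / 4] from the
   parallelogram law. *)
apply: (@strongly_midconvex_unique_minimizer _ _ (l / 8)).
- by rewrite divr_gt0.
- rewrite JE => z; apply: cvgD; apply: cvgM; try exact: cvg_cst.
  + apply: continuous_cvg; first exact: (continuous_sqnorm_dual Bb).
    by apply: cvgB; [exact: cvg_id|exact: cvg_cst].
  + apply: cvg_big => [|k _]; first exact: add_continuous.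
    have [_ _ _ _ /continuous_sqnorm_op Rc] := HR k.
    have [_ _ _ _ /continuous_sqnorm_op Lc] := HL k.
    apply: cvgB; (apply: continuous_cvg; first by [exact: Rc|exact: Lc]).
      by apply: cvgB; [exact: cvg_cst|exact: Qc].
    by apply: cvgB; [exact: Qc|exact: cvg_cst].
- move=> u v; rewrite JE.
  have := sqnorm_dual_midpoint Binv (u - zb) (v - zb).
  have := Bl (u - v).
  have : \sum_(k < N.+1) t k (2^-1 *: (u + v)) <=
      2^-1 * (\sum_(k < N.+1) t k u + \sum_(k < N.+1) t k v).
    by rewrite -big_split mulr_sumr ler_sum.
  rewrite midpointB midpointxx.
  have -> : u - zb - (v - zb) = u - v by rewrite opprB addrA subrK.
  rewrite -/(sqnorm_dual Binv (u - v)).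
  by lra.
Qed.
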